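(* Let $G$ be a group with the Magnus property, let $\Omega_G = \{\langle g\rangle^G \mid g \in G\}$, and let $N \trianglelefteq G$ be a normal subgroup. (1) If $\Omega_G$, partially ordered by inclusion, satisfies the minimal condition, then $G/N$ has the Magnus property. (2) If $N$ is finite, then $G/N$ has the Magnus property.
   Context: $\langle g\rangle^G$ denotes the normal closure of $g$ in $G$. A group $G$ has the Magnus property if, whenever $g,h \in G$ satisfy $\langle g\rangle^G = \langle h\rangle^G$, $g$ is conjugate in $G$ to $h$ or to $h^{-1}$. A partially ordered set satisfies the minimal condition if every non-empty subset has a minimal element. *)

(* Defs.v *)
From HB Require Import structures.
From mathcomp Require Import all_boot all_classical.

Set Implicit Arguments.
Unset Strict Implicit.
Unset Printing Implicit Defensive.

Local Open Scope classical_set_scope.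
Local Open Scope group_scope.
Local Open Scope quotient_scope.

(* A [groupType] may be infinite; the [choiceType] structure it carries exists
   classically on every type, so it does not restrict the groups considered. *)
Definition normal_subgroup (G : groupType) (N : set G) : Prop :=
  [/\ N 1,
      forall x y, N x -> N y -> N (x * y),
      forall x, N x -> N x^-1
    & forall x y, N x -> N (x ^ y)].

Definition normal_closure (G : groupType) (g : G) : set G :=
  smallest (@normal_subgroup G) [set g].

Definition conjugate (G : groupType) (g h : G) : Prop := exists x, h = g ^ x.

Definition magnus_property (G : groupType) : Prop :=
  forall g h : G, normal_closure g = normal_closure h ->
    conjugate g h \/ conjugate g h^-1.

Definition Omega (G : groupType) : set (set G) := range (@normal_closure G).
Arguments Omega G : clear implicits.

Definition minimal_condition (T : Type) (F : set (set T)) : Prop :=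
  forall S : set (set T), S `<=` F -> S !=set0 ->
    exists2 A, S A & forall B, S B -> B `<=` A -> B = A.

Section Quotient.
Variables (G : groupType) (N : set G) (nN : normal_subgroup N).

(* Left cosets; since N need not be decidable, the boolean relation that
   [{eq_quot _}] requires is obtained with the classical [asbool]. *)
Definition coset_rel of normal_subgroup N : rel G :=
  fun x y => `[< N (x^-1 * y) >].

Lemma coset_rel_equiv : equiv_class_of (coset_rel nN).
Proof.
have [N1 NM NV NJ] := nN; split=> [x|x y|y x z].
- by apply/asboolP; rewrite mulVg.
- by apply/asboolP/asboolP=> /NV; rewrite invgM invgK.
- move=> /asboolP xy /asboolP yz; apply/asboolP.
  by have := NM _ _ xy yz; rewrite -!mulgA mulVKg.
Qed.

Canonical coset_rel_equiv_rel := EquivRelPack coset_rel_equiv.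

Definition quotient : Type := {eq_quot coset_rel nN}.

HB.instance Definition _ := Choice.on quotient.
HB.instance Definition _ := EqQuotient.on quotient.

Lemma pi_quotientP (x y : G) : \pi_quotient x = \pi_quotient y <-> N (x^-1 * y).
Proof.
split=> [/eqP|Nxy]; first by rewrite pi_eq_quot => /asboolP.
by apply/eqP; rewrite pi_eq_quot; apply/asboolP.
Qed.

Definition quotient_one : quotient := \pi_quotient 1.
Definition quotient_inv (a : quotient) : quotient :=
  \pi_quotient ((repr a)^-1).
Definition quotient_mul (a b : quotient) : quotient :=
  \pi_quotient (repr a * repr b).

Lemma pi_quotient_inv (x : G) :
  quotient_inv (\pi_quotient x) = \pi_quotient x^-1.
Proof.
have [N1 NM NV NJ] := nN; apply/pi_quotientP.
have /pi_quotientP/NV := reprK (\pi_quotient x).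
by rewrite invgM invgK => /(NJ _ x^-1); rewrite conjgE !invgK -!mulgA mulVKg.
Qed.

Lemma pi_quotient_mul (x y : G) :
  quotient_mul (\pi_quotient x) (\pi_quotient y) = \pi_quotient (x * y).
Proof.
have [N1 NM NV NJ] := nN; apply/pi_quotientP.
have /pi_quotientP Nx := reprK (\pi_quotient x).
have /pi_quotientP Ny := reprK (\pi_quotient y).
have := NM _ _ (NJ _ (repr (\pi_quotient y)) Nx) Ny.
by rewrite conjgE invgM -!mulgA mulVKg.
Qed.

Lemma quotient_mulA : associative quotient_mul.
Proof.
elim/quotW=> x; elim/quotW=> y; elim/quotW=> z.
by rewrite (pi_quotient_mul x y) (pi_quotient_mul y z) !pi_quotient_mul mulgA.
Qed.

Lemma quotient_mul1g : left_id quotient_one quotient_mul.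
Proof. by elim/quotW=> x; rewrite pi_quotient_mul mul1g. Qed.

Lemma quotient_mulg1 : right_id quotient_one quotient_mul.
Proof. by elim/quotW=> x; rewrite pi_quotient_mul mulg1. Qed.

Lemma quotient_mulVg : left_inverse quotient_one quotient_inv quotient_mul.
Proof.
by elim/quotW=> x; rewrite pi_quotient_inv pi_quotient_mul mulVg.
Qed.

Lemma quotient_mulgV : right_inverse quotient_one quotient_inv quotient_mul.
Proof.
by elim/quotW=> x; rewrite pi_quotient_inv pi_quotient_mul mulgV.
Qed.

HB.instance Definition _ := isGroup.Build quotient
  quotient_mulA quotient_mul1g quotient_mulg1 quotient_mulVg quotient_mulgV.

End Quotient.

(* Main.v *)
Require Import Defs.
From HB Require Import structures.
From mathcomp Require Import all_boot all_classical.

(** Let [f] be the projection of [G] onto the quotient; the argument works for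
    any surjective morphism. If [f g] and [f h] have the same normal closure,
    the minimality assumption allows [g] and [h] to be modified inside their
    fibres so as to have the same normal closure in [G], where the Magnus
    property applies. The reason is that, since [f] maps normal
    subgroups onto normal subgroups, the normal closure of any lift of [f g]
    contains a lift of every element of the normal closure of [f g], in
    particular of [f h]; likewise with [g] and [h] exchanged
    ([fibre_meets_normal_closure]). So below the normal closure of a lift [g1]
    of [f g] lies that of a lift [h1] of [f h], and below that one lies the
    normal closure of another lift [g2] of [f g]. If the normal closure of [g1]
    is minimal among those of the lifts of [f g], all three coincide; thus [h1]
    is conjugate to [g1] or to its inverse, and applying [f] concludes
    ([magnus_morphism]).

    A minimal normal closure exists in every nonempty family of normal closures
    when [Omega G] satisfies the minimal condition, and it also exists when the
    kernel, hence each fibre, is finite: a finite family of sets always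
    satisfies the minimal condition. *)

Set Implicit Arguments.
Unset Strict Implicit.
Unset Printing Implicit Defensive.

Local Open Scope classical_set_scope.
Local Open Scope group_scope.
Local Open Scope quotient_scope.

Lemma minimal_condition_sub (T : Type) (F F' : set (set T)) :
  F' `<=` F -> minimal_condition F -> minimal_condition F'.
Proof. by move=> sF'F minF S sSF'; apply: minF; apply: subset_trans sF'F. Qed.

(** Induction on an enumeration: a minimal element [A] of the tail stays
    minimal when [B] is added, unless [B] is below [A], and then [B] is
    minimal. *)
Lemma finite_minimal_condition (T : Type) (F : set (set T)) :
  finite_set F -> minimal_condition F.
Proof.
move=> finF S sSF; move: (sub_finite_set sSF finF) => /finite_seqP[s ->] {S sSF}.
elim: s => [[A]|B s IHs _]; first by rewrite /= inE.
case: s IHs => [_|C s IHs].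
  exists B => /=; first exact: mem_head.
  by move=> A; rewrite inE => /eqP.
have /IHs[A sA minA] : [set` C :: s] !=set0 by exists C; apply: mem_head.
have [sBA|nsBA] := pselect (B `<=` A); last first.
  exists A => /=; first by rewrite inE; apply/orP; right.
  move=> D; rewrite inE => /orP[/eqP->|sD] sDA; [by case: nsBA | exact: minA].
exists B => /=; first exact: mem_head.
move=> D; rewrite inE => /orP[/eqP//|sD] sDB.
have DA : D = A by apply: minA => //; apply: subset_trans sBA.
by apply/seteqP; split=> //; rewrite DA.
Qed.

Lemma normal_closure_mem (G : groupType) (g : G) : normal_closure g g.
Proof. exact: sub_gen_smallest. Qed.

Lemma normal_closure_normal (G : groupType) (g : G) :
  normal_subgroup (normal_closure g).
Proof.
split=> [M [[]]//|x y clx cly M sM|x clx M sM|x y clx M sM];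
  have [[_ MM MV MJ] _] := sM.
- exact: MM (clx M sM) (cly M sM).
- exact: MV (clx M sM).
- exact: MJ (clx M sM).
Qed.

Lemma normal_closure_min (G : groupType) (g : G) (M : set G) :
  normal_subgroup M -> M g -> normal_closure g `<=` M.
Proof. by move=> nM Mg; apply: smallest_sub => // _ ->. Qed.

Section SurjectiveMorphism.
Variables (G H : groupType) (f : UMagmaMorphism.type G H).
Hypothesis f_surj : forall a, exists x, f x = a.

Lemma image_normal_subgroup (M : set G) :
  normal_subgroup M -> normal_subgroup (f @` M).
Proof.
case=> M1 MM MV MJ; split.
- by exists 1; rewrite // gmulf1.
- by move=> _ _ [x Mx <-] [y My <-]; exists (x * y); [apply: MM | rewrite gmulfM].
- by move=> _ [x Mx <-]; exists x^-1; [apply: MV | rewrite gmulfV].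
- move=> _ b [x Mx <-]; have [y <-] := f_surj b.
  by exists (x ^ y); [apply: MJ | rewrite gmulfJ].
Qed.

(** The image of the normal closure of [g] is a normal subgroup through
    [f g]. *)
Lemma fibre_meets_normal_closure (g h : G) :
  normal_closure (f g) (f h) -> exists2 x, normal_closure g x & f x = f h.
Proof.
apply: (@normal_closure_min _ _ (f @` normal_closure g)); last first.
  by exists g => //; exact: normal_closure_mem.
exact/image_normal_subgroup/normal_closure_normal.
Qed.

Lemma conjugate_morph (g h : G) : conjugate g h -> conjugate (f g) (f h).
Proof. by case=> x ->; exists (f x); rewrite gmulfJ. Qed.

Lemma magnus_morphism :
  magnus_property G ->
  (forall g, minimal_condition (@normal_closure G @` [set x | f x = f g])) ->
  magnus_property H.
Proof.
move=> magnusG minG a b; have [g <-] := f_surj a; have [h <-] := f_surj b.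
move=> eq_gh.
have [||_ [g1 /= fg1 <-] min_g1] :=
    minG g (@normal_closure G @` [set x | f x = f g]) => //.
  by exists (normal_closure g), g.
have [|h1 g1h1 fh1] := @fibre_meets_normal_closure g1 h.
  by rewrite fg1 eq_gh; apply: normal_closure_mem.
have [|g2 h1g2 fg2] := @fibre_meets_normal_closure h1 g.
  by rewrite fh1 -eq_gh; apply: normal_closure_mem.
have s21 := normal_closure_min (normal_closure_normal h1) h1g2.
have s10 := normal_closure_min (normal_closure_normal g1) g1h1.
have eq_g : normal_closure g2 = normal_closure g1.
  by apply: min_g1; [exists g2 | apply: subset_trans s10].
have eq_g1h1 : normal_closure g1 = normal_closure h1.
  by apply/seteqP; split=> //; rewrite -eq_g.
rewrite -fg1 -fh1 -gmulfV.
by case: (magnusG _ _ eq_g1h1) => /conjugate_morph; [left | right].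
Qed.

End SurjectiveMorphism.

Section QuotientMap.
Variables (G : groupType) (N : set G) (nN : normal_subgroup N).

Definition quotient_map (x : G) : quotient nN := \pi_(quotient nN) x.

Lemma quotient_map_monoid_morphism :
  quotient_map 1 = 1 /\ {morph quotient_map : x y / x * y}.
Proof. by split=> // x y; rewrite /quotient_map -pi_quotient_mul. Qed.

HB.instance Definition _ :=
  isUMagmaMorphism.Build G (quotient nN) quotient_map
    quotient_map_monoid_morphism.

Lemma quotient_map_surj (a : quotient nN) : exists x, quotient_map x = a.
Proof. by elim/quotW: a => x; exists x. Qed.

Lemma finite_quotient_map_fibre (g : G) :
  finite_set N -> finite_set [set x | quotient_map x = quotient_map g].
Proof.
move=> finN; apply: sub_finite_set (finite_image (fun n => g * n) finN).
move=> x /= /esym/pi_quotientP Nx.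
by exists (g^-1 * x) => //; rewrite mulgA mulgV mul1g.
Qed.

End QuotientMap.

Theorem corollary2p5 (G : groupType) (N : set G) (nN : normal_subgroup N)
    (magnusG : magnus_property G) :
  (minimal_condition (Omega G) -> magnus_property (quotient nN)) /\
  (finite_set N -> magnus_property (quotient nN)).
Proof.
split=> [minG | finN];
  apply: (magnus_morphism (@quotient_map_surj G N nN)) => // g.
- by apply: minimal_condition_sub minG => _ [x _ <-]; exists x.
- exact/finite_minimal_condition/finite_image/finite_quotient_map_fibre.
Qed.
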